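(* Let $\tilde A_i=(a_i;\,l_i^{\mu L},r_i^{\mu L},l_i^{\mu U},r_i^{\mu U};\,l_i^{\nu L},r_i^{\nu L},l_i^{\nu U},r_i^{\nu U})_{LR}$, $i=1,2$, be two $LR$-type IVIFNs (with the same shape functions $L,R,L',R'$). Then: (i) $\tilde A_1\oplus\tilde A_2=(a_1+a_2;\,l_1^{\mu L}+l_2^{\mu L},\,r_1^{\mu L}+r_2^{\mu L},\,l_1^{\mu U}+l_2^{\mu U},\,r_1^{\mu U}+r_2^{\mu U};\,l_1^{\nu L}+l_2^{\nu L},\,r_1^{\nu L}+r_2^{\nu L},\,l_1^{\nu U}+l_2^{\nu U},\,r_1^{\nu U}+r_2^{\nu U})_{LR}$, where the conditions for $LR$-type representation of $\tilde A_1\oplus\tilde A_2$ are satisfied; (ii) $\tilde A_1\ominus\tilde A_2=(a_1-a_2;\,l_1^{\mu L}+r_2^{\mu L},\,r_1^{\mu L}+l_2^{\mu L},\,l_1^{\mu U}+r_2^{\mu U},\,r_1^{\mu U}+l_2^{\mu U};\,l_1^{\nu L}+r_2^{\nu L},\,r_1^{\nu L}+l_2^{\nu L},\,l_1^{\nu U}+r_2^{\nu U},\,r_1^{\nu U}+l_2^{\nu U})_{LR}$, where the conditions for $LR$-type representation of $\tilde A_1\ominus\tilde A_2$ are satisfied.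
   Context: A shape function is a continuous, strictly decreasing, invertible $f:[0,\infty)\to[0,1]$ with $f(0)=1$ and $\lim_{x\to\infty}f(x)=0$. Fix shape functions $L,R,L',R'$. An interval-valued intuitionistic fuzzy set on $\mathbb R$ assigns to each $x$ a membership interval $\mu(x)=[\mu^L(x),\mu^U(x)]\subseteq[0,1]$ and a non-membership interval $\nu(x)=[\nu^L(x),\nu^U(x)]\subseteq[0,1]$ with $0\le\sup\mu(x)+\sup\nu(x)\le 1$. It is an interval-valued intuitionistic fuzzy number (IVIFN) if it is convex ($\mu^L,\mu^U$ quasi-concave, $\nu^L,\nu^U$ quasi-convex), normal (there are $x_1,x_2$ with $\mu(x_1)=1$, $\nu(x_2)=1$), and $\mu^L,\mu^U,\nu^L,\nu^U$ are piecewise continuous. An $LR$-type IVIFN, written $\tilde A=(a;l^{\mu L},r^{\mu L},l^{\mu U},r^{\mu U};l^{\nu L},r^{\nu L},l^{\nu U},r^{\nu U})_{LR}$, is an IVIFN with mean value $a\in\mathbb R$ and eight positive real spreads such that: $\mu^L(x)=L((a-x)/l^{\mu L})$ on $[a-l^{\mu L},a]$, $R((x-a)/r^{\mu L})$ on $[a,a+r^{\mu L}]$, and $0$ otherwise; $\mu^U$ has the same form with $L',R',l^{\mu U},r^{\mu U}$; $\nu^L(x)=1-L((a-x)/l^{\nu L})$ on $[a-l^{\nu L},a]$, $1-R((x-a)/r^{\nu L})$ on $[a,a+r^{\nu L}]$, and $1$ otherwise; $\nu^U$ has the same form with $L',R',l^{\nu U},r^{\nu U}$. The conditions for $LR$-type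 representation are: all eight spreads are positive; $l^{\mu U}\ge l^{\mu L}$, $r^{\mu U}\ge r^{\mu L}$, $l^{\nu L}\ge l^{\nu U}$, $r^{\nu L}\ge r^{\nu U}$, $l^{\nu L}\ge l^{\mu L}$, $r^{\nu L}\ge r^{\mu L}$, $l^{\nu U}\ge l^{\mu U}$, $r^{\nu U}\ge r^{\mu U}$; and $0\le\sup\mu(x)+\sup\nu(x)\le1$ for all $x\in\mathbb R$. For $\alpha,\beta\in(0,1]$ with $\alpha+\beta\le1$, the cuts of $\tilde A$ are $A^L_\alpha=[a-l^{\mu L}L^{-1}(\alpha),\,a+r^{\mu L}R^{-1}(\alpha)]$, $A^U_\alpha=[a-l^{\mu U}(L')^{-1}(\alpha),\,a+r^{\mu U}(R')^{-1}(\alpha)]$ (lower and upper $\alpha$-cuts for membership), and $A^L_\beta=[a-l^{\nu L}L^{-1}(1-\beta),\,a+r^{\nu L}R^{-1}(1-\beta)]$, $A^U_\beta=[a-l^{\nu U}(L')^{-1}(1-\beta),\,a+r^{\nu U}(R')^{-1}(1-\beta)]$ (lower and upper $\beta$-cuts for non-membership). The operations $\oplus$ and $\ominus$ are defined cutwise by interval arithmetic: each of the four families of cuts of $\tilde A_1\oplus\tilde A_2$ (respectively $\tilde A_1\ominus\tilde A_2$) is the interval sum (respectively interval difference) of the corresponding cuts of $\tilde A_1$ and $\tilde A_2$, e.g. $(\tilde A_1\oplus\tilde A_2)^L_\alpha=A^L_{1\alpha}+A^L_{2\alpha}$ and $(\tilde A_1\ominus\tilde A_2)^L_\alpha=A^L_{1\alpha}-A^L_{2\alpha}$,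 where $I\pm J=\{x\pm y:x\in I,\,y\in J\}$.
   Formalization: In (ii), the equality for the difference and its being an LR-type IVIFN are stated only when L=R and L'=R' (otherwise the equality is false); the representation conditions in (ii) hold for all shapes. Shape functions are taken invertible onto (0,1]. *)

(* Defs.v *)
From mathcomp Require Export all_boot all_order all_algebra.
From mathcomp Require Export all_classical all_reals all_analysis.

Set Implicit Arguments.
Unset Strict Implicit.
Unset Printing Implicit Defensive.

Export Order.TTheory GRing.Theory Num.Theory.
Export numFieldNormedType.Exports.

Local Open Scope classical_set_scope.
Local Open Scope ring_scope.

(* A shape function is only meaningful on [0, +oo[.  It decreases strictly
   to 0, hence never takes the value 0: "invertible" means invertible onto its
   range ]0, 1], which is contained in [0, 1]. *)
Record shape_function (K : realType) (f : K -> K) : Prop := ShapeFunction {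
  shape_continuous : {within `[0, +oo[, continuous f};
  shape_decreasing : {in `[0, +oo[ &, {homo f : x y /~ x < y}};
  shape_invertible : set_bij `[0, +oo[ `]0, 1] f;
  shape0 : f 0 = 1;
  shape_limit : f x @[x --> +oo] --> 0 }.

Definition shape_inv (K : realType) (f : K -> K) : K -> K :=
  'pinv_(fun=> 0) `[0, +oo[ f.

Record ivif (K : realType) := IVIF {
  muL : K -> K; muU : K -> K; nuL : K -> K; nuU : K -> K }.

Definition mu (K : realType) (A : ivif K) (x : K) : set K :=
  `[muL A x, muU A x].

Definition nu (K : realType) (A : ivif K) (x : K) : set K :=
  `[nuL A x, nuU A x].

Definition sup_condition (K : realType) (A : ivif K) : Prop :=
  forall x, 0 <= sup (mu A x) + sup (nu A x) <= 1.

Record is_ivif_set (K : realType) (A : ivif K) : Prop := IsIvifSet {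
  mu_interval : forall x, 0 <= muL A x <= muU A x /\ muU A x <= 1;
  nu_interval : forall x, 0 <= nuL A x <= nuU A x /\ nuU A x <= 1;
  ivif_sup : sup_condition A }.

Definition quasi_concave (K : realType) (f : K -> K) : Prop :=
  forall x y t : K, 0 <= t <= 1 ->
    Num.min (f x) (f y) <= f (t * x + (1 - t) * y).

Definition quasi_convex (K : realType) (f : K -> K) : Prop :=
  forall x y t : K, 0 <= t <= 1 ->
    f (t * x + (1 - t) * y) <= Num.max (f x) (f y).

Definition piecewise_continuous (K : realType) (f : K -> K) : Prop :=
  finite_set [set x | ~ {for x, continuous f}] /\
  forall x, cvg (f y @[y --> x^'-]) /\ cvg (f y @[y --> x^'+]).

Record ivifn (K : realType) (A : ivif K) : Prop := Ivifn {
  ivifn_set : is_ivif_set A;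
  ivifn_convex : [/\ quasi_concave (muL A), quasi_concave (muU A),
                     quasi_convex (nuL A) & quasi_convex (nuU A)];
  ivifn_normal : exists x1 x2, mu A x1 = [set 1] /\ nu A x2 = [set 1];
  ivifn_pwc : [/\ piecewise_continuous (muL A), piecewise_continuous (muU A),
                  piecewise_continuous (nuL A) &
                  piecewise_continuous (nuU A)] }.

(* The tuple (a; l^muL, r^muL, l^muU, r^muU; l^nuL, r^nuL, l^nuU, r^nuU). *)
Record lr_tuple (K : realType) := LR {
  mean : K;
  lmuL : K; rmuL : K; lmuU : K; rmuU : K;
  lnuL : K; rnuL : K; lnuU : K; rnuU : K }.

Definition lr_profile (K : realType) (f g : K -> K) (a l r x : K) : K :=
  if a - l <= x <= a then f ((a - x) / l)
  else if a <= x <= a + r then g ((x - a) / r)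
  else 0.

(* The non-membership value 1 off the support is 1 - lr_profile as well. *)
Definition lr_ivif (K : realType) (L R L' R' : K -> K) (A : lr_tuple K) :
    ivif K :=
  {| muL := fun x => lr_profile L R (mean A) (lmuL A) (rmuL A) x;
     muU := fun x => lr_profile L' R' (mean A) (lmuU A) (rmuU A) x;
     nuL := fun x => 1 - lr_profile L R (mean A) (lnuL A) (rnuL A) x;
     nuU := fun x => 1 - lr_profile L' R' (mean A) (lnuU A) (rnuU A) x |}.

Record lr_conditions (K : realType) (L R L' R' : K -> K) (A : lr_tuple K) :
    Prop := LRConditions {
  lr_mu_gt0 : [/\ 0 < lmuL A, 0 < rmuL A, 0 < lmuU A & 0 < rmuU A];
  lr_nu_gt0 : [/\ 0 < lnuL A, 0 < rnuL A, 0 < lnuU A & 0 < rnuU A];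
  lr_mu_le : lmuL A <= lmuU A /\ rmuL A <= rmuU A;
  lr_nu_le : lnuU A <= lnuL A /\ rnuU A <= rnuL A;
  lr_munuL_le : lmuL A <= lnuL A /\ rmuL A <= rnuL A;
  lr_munuU_le : lmuU A <= lnuU A /\ rmuU A <= rnuU A;
  lr_sup : sup_condition (lr_ivif L R L' R' A) }.

Definition lr_ivifn (K : realType) (L R L' R' : K -> K) (A : lr_tuple K) :
    Prop :=
  ivifn (lr_ivif L R L' R' A) /\ lr_conditions L R L' R' A.

Definition cut_muL (K : realType) (L R : K -> K) (A : lr_tuple K) (alpha : K) :
    set K :=
  `[mean A - lmuL A * shape_inv L alpha, mean A + rmuL A * shape_inv R alpha].

Definition cut_muU (K : realType) (L' R' : K -> K) (A : lr_tuple K)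
    (alpha : K) : set K :=
  `[mean A - lmuU A * shape_inv L' alpha, mean A + rmuU A * shape_inv R' alpha].

Definition cut_nuL (K : realType) (L R : K -> K) (A : lr_tuple K) (beta : K) :
    set K :=
  `[mean A - lnuL A * shape_inv L (1 - beta),
    mean A + rnuL A * shape_inv R (1 - beta)].

Definition cut_nuU (K : realType) (L' R' : K -> K) (A : lr_tuple K)
    (beta : K) : set K :=
  `[mean A - lnuU A * shape_inv L' (1 - beta),
    mean A + rnuU A * shape_inv R' (1 - beta)].

Definition interval_add (K : realType) (I J : set K) : set K :=
  [set x + y | x in I & y in J].

Definition interval_sub (K : realType) (I J : set K) : set K :=
  [set x - y | x in I & y in J].

(* B is the result of combining A1 and A2 cutwise by the interval operation
   op. *)
Definition cutwise (K : realType) (op : set K -> set K -> set K)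
    (L R L' R' : K -> K) (A1 A2 B : lr_tuple K) : Prop :=
  forall alpha beta : K,
    0 < alpha <= 1 -> 0 < beta <= 1 -> alpha + beta <= 1 ->
    [/\ cut_muL L R B alpha = op (cut_muL L R A1 alpha) (cut_muL L R A2 alpha),
        cut_muU L' R' B alpha =
          op (cut_muU L' R' A1 alpha) (cut_muU L' R' A2 alpha),
        cut_nuL L R B beta = op (cut_nuL L R A1 beta) (cut_nuL L R A2 beta) &
        cut_nuU L' R' B beta =
          op (cut_nuU L' R' A1 beta) (cut_nuU L' R' A2 beta)].

Definition is_oplus (K : realType) := cutwise (@interval_add K).

Definition is_ominus (K : realType) := cutwise (@interval_sub K).

(* Main.v *)
(* Write both branches of an LR profile through one nonincreasing function of
   the distance to the mean, so that the profile is a minimum of a nondecreasing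
   and a nonincreasing function.  The order between the lower and upper profiles
   survives the addition of spreads because a mediant (l1 + l2) / (l1' + l2') is
   at most one of the ratios l1 / l1', l2 / l2'.  For the difference, a left
   spread is added to a right one, whence the hypotheses L = R and L' = R'. *)
Require Import Defs.
From mathcomp Require Import ring lra.

Set Implicit Arguments.
Unset Strict Implicit.
Unset Printing Implicit Defensive.

Local Open Scope classical_set_scope.
Local Open Scope ring_scope.

Section ShapeFunctions.
Context {K : realType}.
Implicit Types (f g : K -> K) (a l r p q t u v x y : K).

(** * Shape functions on the half-line and their inverses *)

Lemma shape_anti f x y : shape_function f -> 0 <= x -> x <= y -> f y <= f x.
Proof.
move=> hf x0; rewrite le_eqVlt => /predU1P[->//|xy].
by apply/ltW/(shape_decreasing hf) => //; rewrite in_itv/= andbT; lra.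
Qed.

Lemma shape_gt0 f x : shape_function f -> 0 <= x -> 0 < f x.
Proof.
move=> hf x0; have [h _ _] := shape_invertible hf.
have /h : `[0, +oo[%classic x by rewrite /= in_itv/= x0.
by rewrite /= in_itv/= => /andP[].
Qed.

Lemma shape_le1 f x : shape_function f -> 0 <= x -> f x <= 1.
Proof. by move=> hf x0; rewrite -(shape0 hf); apply: shape_anti. Qed.

Lemma shape_inv_ge0 f y : shape_function f -> 0 < y <= 1 -> 0 <= shape_inv f y.
Proof.
move=> hf y01; have [h _ _] := bijpinv_bij (fun=> 0) (shape_invertible hf).
have /h : `]0, 1]%classic y by rewrite /= in_itv.
by rewrite /= in_itv/= andbT.
Qed.

Lemma shape_invK f y : shape_function f -> 0 < y <= 1 -> f (shape_inv f y) = y.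
Proof.
move=> hf y01; have [_ _ h] := shape_invertible hf.
apply: pinvK; rewrite inE; apply: h; by rewrite /= in_itv.
Qed.

Lemma shape_inj f x y : shape_function f -> 0 <= x -> 0 <= y ->
  f x = f y -> x = y.
Proof.
move=> hf x0 y0 fxy; have [_ h _] := shape_invertible hf.
by apply: h => //; rewrite inE /= in_itv/= ?x0 ?y0.
Qed.

(** Both inverse values are nonnegative and [g] sends both to [y], so injectivity of [g] on the
    half-line identifies them. *)
Lemma eq_shape_inv f g y : shape_function f -> shape_function g ->
  {in `[0, +oo[, f =1 g} -> 0 < y <= 1 -> shape_inv f y = shape_inv g y.
Proof.
move=> hf hg fg y01; apply: (shape_inj hg); [exact: shape_inv_ge0..|].
rewrite -fg ?in_itv/= ?shape_inv_ge0//.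
by rewrite !shape_invK.
Qed.

Lemma near_eq_cvg_to (F : set_system K) {FF : Filter F} f g l :
  {near F, f =1 g} -> g @ F --> l -> f @ F --> l.
Proof.
by move=> fg; apply: cvg_trans; apply: near_eq_cvg; apply: filterS fg => y ->.
Qed.

(** Precomposing with the positive part extends [f] to the left of 0 by the constant [f 0], which
    turns continuity within the half-line into continuity on the whole line. *)
Lemma continuous_shape_max f : shape_function f ->
  continuous (fun x => f (Num.max x 0)).
Proof.
move=> hf; have /continuous_within_itvcyP[cpos c0] := shape_continuous hf.
move=> x; have [x0|x0|->] := ltgtP x 0; rewrite /continuous_at.
- apply: (@near_eq_cvg_to _ _ _ (cst (f (Num.max x 0)))); last exact: cvg_cst.
  near=> y => /=; congr f; rewrite !max_r ?(ltW x0)//.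
  by apply/ltW; near: y; exact: lt_nbhsl.
- rewrite max_l ?(ltW x0)//.
  apply: (@near_eq_cvg_to _ _ _ f); last by apply: cpos; rewrite in_itv/= x0.
  near=> y; congr f; rewrite max_l//.
  by apply/ltW; near: y; exact: lt_nbhsr.
- apply/left_right_continuousP; rewrite max_l//; split.
  + apply: (@near_eq_cvg_to _ _ _ (cst (f 0))); last exact: cvg_cst.
    near=> y => /=; congr f; rewrite max_r//.
  + apply: (near_eq_cvg_to _ c0).
    near=> y; congr f; rewrite max_l//.
Unshelve. all: by end_near. Qed.

(** * One-sided profiles and their comparison *)

(** Here [t] is the signed distance to the mean. On the far side of the mean, [t <= 0], the positive
    part gives [f 0 = 1], which is neutral in a minimum with values at most 1. At [t = l] the value
    is [f 1 > 0], so there is a jump to 0. *)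
Definition lr_side f l t : K := if t <= l then f (Num.max (t / l) 0) else 0.

Lemma lr_side_le0 f l t : shape_function f -> 0 < l -> t <= 0 ->
  lr_side f l t = 1.
Proof.
move=> hf l0 t0; rewrite /lr_side ifT; last by lra.
by rewrite max_r ?shape0// mulr_le0_ge0// invr_ge0 ltW.
Qed.

Lemma lr_sideE f l t : shape_function f -> 0 < l -> 0 <= t <= l ->
  lr_side f l t = f (t / l).
Proof.
move=> hf l0 /andP[t0 tl]; rewrite /lr_side tl max_l//.
by rewrite mulr_ge0// invr_ge0 ltW.
Qed.

Lemma lr_side_gt f l t : l < t -> lr_side f l t = 0.
Proof. by move=> lt; rewrite /lr_side leNgt lt. Qed.

Lemma lr_side_ge0 f l t : shape_function f -> 0 <= lr_side f l t.
Proof.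
move=> hf; rewrite /lr_side; case: ifP => // _.
by apply/ltW/shape_gt0 => //; rewrite le_max lexx orbT.
Qed.

Lemma lr_side_le1 f l t : shape_function f -> lr_side f l t <= 1.
Proof.
move=> hf; rewrite /lr_side; case: ifP => // _.
by apply/shape_le1 => //; rewrite le_max lexx orbT.
Qed.

Lemma lr_side_anti f l x y : shape_function f -> 0 < l -> x <= y ->
  lr_side f l y <= lr_side f l x.
Proof.
move=> hf l0 xy; rewrite {1}/lr_side; case: ifP => yl; last exact: lr_side_ge0.
rewrite /lr_side (le_trans xy yl).
apply: shape_anti => //; first by rewrite le_max lexx orbT.
by rewrite ge_max !le_max lexx !orbT ler_pM2r ?invr_gt0// xy.
Qed.

Lemma lr_side_spread f l l' t : shape_function f -> 0 < l -> l <= l' ->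
  lr_side f l t <= lr_side f l' t.
Proof.
move=> hf l0 ll'; have l'0 : 0 < l' by lra.
have [t0|t0] := leP t 0; first by rewrite !lr_side_le0.
have [tl|tl] := leP t l; last by rewrite lr_side_gt// lr_side_ge0.
rewrite !lr_sideE ?(ltW t0)//=; last exact: le_trans ll'.
apply: shape_anti => //; first by rewrite divr_ge0 ?ltW.
by rewrite ler_pM2l// lef_pV2.
Qed.

(** With [f] and [g] unrelated otherwise, each hypothesis is a comparison [f u <= g (u * l / m)] for
    [u] in [0, 1], governed by the ratio [l / m] alone. *)
Lemma lr_side_add f g l1 l2 m1 m2 :
  shape_function f -> shape_function g ->
  0 < l1 -> 0 < l2 -> l1 <= m1 -> l2 <= m2 ->
  (forall t, lr_side f l1 t <= lr_side g m1 t) ->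
  (forall t, lr_side f l2 t <= lr_side g m2 t) ->
  forall t, lr_side f (l1 + l2) t <= lr_side g (m1 + m2) t.
Proof.
move=> hf hg l10 l20 lm1 lm2 h1 h2 t.
have l0 : 0 < l1 + l2 by lra.
have m0 : 0 < m1 + m2 by lra.
have [t0|t0] := leP t 0; first by rewrite !lr_side_le0.
have [tl|tl] := leP t (l1 + l2); last first.
  by rewrite lr_side_gt// lr_side_ge0.
rewrite !lr_sideE ?(ltW t0)//=; last by lra.
set u := t / (l1 + l2).
have u0 : 0 <= u by rewrite divr_ge0// ltW.
have u1 : u <= 1 by rewrite ler_pdivrMr// mul1r.
(* The assumption on products says that [l / m] is at least [(l1 + l2) / (m1 + m2)]. Taking the
   hypothesis at [u * l] gives [f u <= g (u * l / m)], and [u * l / m >= t / (m1 + m2)], so [g],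
   being decreasing, finishes. *)
have key l m : 0 < l -> l <= m ->
    (forall t, lr_side f l t <= lr_side g m t) ->
    m * (l1 + l2) <= l * (m1 + m2) -> f u <= g (t / (m1 + m2)).
  move=> lgt0 lm /(_ (u * l)) + ratio.
  have mgt0 : 0 < m by lra.
  have ul0 : 0 <= u * l by rewrite mulr_ge0// ltW.
  have ull : u * l <= l by rewrite ger_pMl.
  rewrite !lr_sideE ?ul0 ?ull//=; last exact: le_trans lm.
  rewrite mulfK ?gt_eqF// => /le_trans; apply.
  apply: shape_anti => //; first by rewrite divr_ge0// ltW.
  rewrite ler_pdivrMr// mulrAC ler_pdivlMr// /u -!mulrA ler_pM2l//.
  by rewrite ler_pdivlMl// mulrC.
(* The pair with the larger ratio [l / m] dominates the mediant. *)
have [c|c] := leP (l2 * m1) (l1 * m2).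
  by apply: (key l1 m1) => //; rewrite !mulrDr; nra.
by apply: (key l2 m2) => //; rewrite !mulrDr; nra.
Qed.

Lemma lr_profileE f g a l r x : shape_function f -> shape_function g ->
  0 < l -> 0 < r ->
  lr_profile f g a l r x =
    Num.min (lr_side f l (a - x)) (lr_side g r (x - a)).
Proof.
move=> hf hg l0 r0; rewrite /lr_profile.
have [xa|ax] := leP x a.
  rewrite (@lr_side_le0 g)//; last by lra.
  rewrite min_l ?lr_side_le1// andbT; case: ifP => xl.
    by rewrite lr_sideE//; lra.
  rewrite /lr_side ifF; last by lra.
  case: ifP => // xar; lra.
rewrite andbF (@lr_side_le0 f)//; last by lra.
rewrite min_r ?lr_side_le1// (ltW ax)/=; case: ifP => xr.
  by rewrite lr_sideE//; lra.
by rewrite /lr_side ifF//; lra.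
Qed.

(** At [a - t] and [a + t] with [t > 0], the side facing away from the point equals 1, so each side
    can be read off the profile separately. *)
Lemma lr_profile_leP f g f' g' a l r l' r' :
  shape_function f -> shape_function g ->
  shape_function f' -> shape_function g' ->
  0 < l -> 0 < r -> 0 < l' -> 0 < r' ->
  (forall x, lr_profile f g a l r x <= lr_profile f' g' a l' r' x) <->
  (forall t, lr_side f l t <= lr_side f' l' t) /\
  (forall t, lr_side g r t <= lr_side g' r' t).
Proof.
move=> hf hg hf' hg' l0 r0 l'0 r'0; split=> [h|[hl hr] x]; last first.
  by rewrite !lr_profileE// le_min !ge_min hl hr orbT.
split=> t; (have [t0|t0] := leP t 0; first by rewrite !lr_side_le0).
  have := h (a - t); rewrite !lr_profileE// subKr.
  rewrite (@lr_side_le0 g)//; last by lra.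
  rewrite (@lr_side_le0 g')//; last by lra.
  by rewrite !min_l ?lr_side_le1.
have := h (a + t); rewrite !lr_profileE// (_ : a + t - a = t); last by lra.
rewrite (@lr_side_le0 f)//; last by lra.
rewrite (@lr_side_le0 f')//; last by lra.
by rewrite !min_r ?lr_side_le1.
Qed.

Lemma lr_profile_itv f g a l r x : shape_function f -> shape_function g ->
  0 < l -> 0 < r -> 0 <= lr_profile f g a l r x <= 1.
Proof.
move=> hf hg l0 r0; rewrite lr_profileE//.
by rewrite le_min !lr_side_ge0//= ge_min lr_side_le1.
Qed.

Lemma lr_profile_mean f g a l r : shape_function f -> 0 < l ->
  lr_profile f g a l r a = 1.
Proof.
by move=> hf l0; rewrite /lr_profile lexx ifT ?subrr ?mul0r ?shape0//; lra.
Qed.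

(** The left side is nondecreasing in the point, the right side nonincreasing. At [z], between [x]
    and [y], the first is thus bounded below by its value at the smaller endpoint, the second by its
    value at the larger. *)
Lemma quasi_concave_lr_profile f g a l r :
  shape_function f -> shape_function g -> 0 < l -> 0 < r ->
  quasi_concave (lr_profile f g a l r).
Proof.
move=> hf hg l0 r0 x y t t01; rewrite !lr_profileE//.
set z := t * x + (1 - t) * y; move: t01 => /andP[t0 t1].
have zx : z - x = (1 - t) * (y - x) by rewrite /z; ring.
have yz : y - z = t * (y - x) by rewrite /z; ring.
rewrite le_min !ge_min; have [xy|yx] := leP x y.
  have xz : x <= z by rewrite -subr_ge0 zx mulr_ge0//; lra.
  have zy : z <= y by rewrite -subr_ge0 yz mulr_ge0//; lra.
  rewrite (@lr_side_anti f l (a - z) (a - x))//; last by lra.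
  by rewrite (@lr_side_anti g r (z - a) (y - a)) ?orbT//; lra.
have {}zx : z <= x by rewrite -subr_le0 zx mulr_ge0_le0//; lra.
have {}yz : y <= z by rewrite -subr_le0 yz mulr_ge0_le0//; lra.
rewrite (@lr_side_anti f l (a - z) (a - y)) ?orbT//; last by lra.
by rewrite (@lr_side_anti g r (z - a) (x - a)) ?orbT//; lra.
Qed.

(** * Piecewise continuity *)

Lemma piecewise_continuous_cutoff (h : K -> K) p q : continuous h -> p < q ->
  piecewise_continuous (fun x => if p <= x <= q then h x else 0).
Proof.
move=> ch pq; set k := fun x => _.
(* Every one-sided limit falls under one of two cases: along the filter, [k] agrees eventually with
   [h] or with 0. *)
have cin x (F : set_system K) : ProperFilter F -> F --> x ->
    {near F, k =1 h} -> cvg (k @ F).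
  move=> FF Fx kh; apply/cvg_ex; exists (h x).
  exact: near_eq_cvg_to kh (cvg_comp _ _ Fx (ch x)).
have cout (F : set_system K) : ProperFilter F ->
    {near F, k =1 cst 0} -> cvg (k @ F).
  move=> FF k0; apply/cvg_ex; exists 0.
  exact: near_eq_cvg_to k0 (cvg_cst _).
split; last move=> x; first last.
  split.
    (* For left limits, [p] belongs with the zero region and [q] with the region of [h]; for right
       limits the roles are exchanged. *)
    have [xp|px] := leP x p.
      apply: cout; near=> y; rewrite /k ifF//; apply/negP => /andP[+ _].
      by apply/negP; rewrite -ltNge (lt_le_trans _ xp)//; near: y; exact: nbhs_left_lt.
    have [qx|xq] := ltP q x.
      apply: cout; near=> y; rewrite /k ifF//; apply/negP => /andP[_].
      by apply/negP; rewrite -ltNge; near: y; exact: nbhs_left_gt.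
    apply: (cin x); first exact: cvg_within.
    near=> y; rewrite /k ifT//; apply/andP; split.
      by apply/ltW; near: y; exact: nbhs_left_gt.
    by rewrite (le_trans _ xq)//; apply/ltW; near: y; exact: nbhs_left_lt.
  have [xp|px] := ltP x p.
    apply: cout; near=> y; rewrite /k ifF//; apply/negP => /andP[+ _].
    by apply/negP; rewrite -ltNge; near: y; exact: nbhs_right_lt.
  have [qx|xq] := leP q x.
    apply: cout; near=> y; rewrite /k ifF//; apply/negP => /andP[_].
    by apply/negP; rewrite -ltNge (le_lt_trans qx)//; near: y; exact: nbhs_right_gt.
  apply: (cin x); first exact: cvg_within.
  near=> y; rewrite /k ifT//; apply/andP; split.
    by rewrite (le_trans px)//; apply/ltW; near: y; exact: nbhs_right_gt.
  by apply/ltW; near: y; exact: nbhs_right_lt.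
(* Away from [p] and [q], [k] agrees with [h] or with 0 on a full neighbourhood. *)
apply: (@sub_finite_set _ _ [set p; q]); last exact: finite_set2.
move=> x /= nc; apply: contrapT => /not_orP[/eqP xp /eqP xq]; apply: nc.
have cout' : {near x, k =1 cst 0} -> {for x, continuous k}.
  move=> k0; have kx : k x = 0 by exact: nbhs_singleton k0.
  rewrite /prop_for /continuous_at kx.
  exact: near_eq_cvg_to k0 (cvg_cst _).
have [xltp|px|/eqP] := ltgtP x p; last by rewrite (negbTE xp).
  apply: cout'; near=> y; rewrite /k ifF//; apply/negP => /andP[+ _].
  by apply/negP; rewrite -ltNge; near: y; exact: lt_nbhsl.
have [xltq|qx|/eqP] := ltgtP x q; last by rewrite (negbTE xq).
  have kh : {near x, k =1 h}.
    near=> y; rewrite /k ifT//; apply/andP; split; apply/ltW; near: y.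
      exact: lt_nbhsr.
    exact: lt_nbhsl.
  have kx : k x = h x by exact: nbhs_singleton kh.
  rewrite /prop_for /continuous_at kx.
  exact: near_eq_cvg_to kh (ch x).
apply: cout'; near=> y; rewrite /k ifF//; apply/negP => /andP[_].
by apply/negP; rewrite -ltNge; near: y; exact: lt_nbhsr.
Unshelve. all: by end_near. Qed.

Lemma piecewise_continuous_lr_profile f g a l r :
  shape_function f -> shape_function g -> 0 < l -> 0 < r ->
  piecewise_continuous (lr_profile f g a l r).
Proof.
move=> hf hg l0 r0.
(* [h] is the minimum of the two sides with their jumps to 0 removed; the profile is [h] cut off
   outside the support. *)
pose h x := Num.min (f (Num.max ((a - x) / l) 0)) (g (Num.max ((x - a) / r) 0)).
have ch : continuous h.
  have cf : continuous (fun x => f (Num.max ((a - x) / l) 0)).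
    move=> x; apply: (@continuous_comp _ _ _ (fun x => (a - x) / l)
      (fun t => f (Num.max t 0))); last exact: continuous_shape_max.
    by apply: cvgM; [apply: cvgB => //; exact: cvg_cst|exact: cvg_cst].
  have cg : continuous (fun x => g (Num.max ((x - a) / r) 0)).
    move=> x; apply: (@continuous_comp _ _ _ (fun x => (x - a) / r)
      (fun t => g (Num.max t 0))); last exact: continuous_shape_max.
    by apply: cvgM; [apply: cvgB => //; exact: cvg_cst|exact: cvg_cst].
  by move=> x; apply: continuous_min; [exact: cf|exact: cg].
suff -> : lr_profile f g a l r = fun x => if a - l <= x <= a + r then h x else 0.
  by apply: piecewise_continuous_cutoff => //; lra.
apply/funext => x; rewrite lr_profileE// /h.
case: ifP => [/andP[lx xr]|/negbT]; first by rewrite /lr_side !ifT//; lra.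
rewrite negb_and -!ltNge => /orP[xl|rx].
  by rewrite (@lr_side_gt f)//; [rewrite min_l// lr_side_ge0|lra].
by rewrite (@lr_side_gt g)//; [rewrite min_r// lr_side_ge0|lra].
Qed.

Lemma piecewise_continuous_1sub f : piecewise_continuous f ->
  piecewise_continuous (fun x => 1 - f x).
Proof.
move=> [fin lim]; split.
  apply: sub_finite_set fin => x /= nc c; apply: nc.
  by apply: cvgB; [exact: cvg_cst|exact: c].
by move=> x; have [? ?] := lim x; split; apply: is_cvgB => //; exact: is_cvg_cst.
Qed.

Lemma quasi_convex_1sub f : quasi_concave f -> quasi_convex (fun x => 1 - f x).
Proof.
move=> h x y t t01; have := h x y t t01.
by rewrite le_max ge_min => /orP[]?; apply/orP; [left|right]; lra.
Qed.

(** * Suprema and arithmetic of closed intervals *)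

(** If [q < p] the interval is empty and [sup] takes its default value 0. *)
Lemma sup_itvcc_bounds p q : 0 <= q -> 0 <= sup `[p, q] <= q.
Proof.
move=> q0; have [pq|qp] := leP p q; first by rewrite sup_itvcc// q0 lexx.
by rewrite set_itv_ge ?sup0 ?lexx// bnd_simp -ltNge.
Qed.

Lemma interval_addE p q r t : p <= q -> r <= t ->
  interval_add `[p, q] `[r, t] = `[p + r, q + t]%classic.
Proof.
move=> pq rt; apply/seteqP; split=> [_ [x + [y + <-]]|z] /=; rewrite !in_itv/=.
  by rewrite !in_itv/= => /andP[? ?] /andP[? ?]; apply/andP; split; lra.
(* The second summand is taken as large as possible, [t]; if this pushes the first below [p], the
   first is set to [p] instead. *)
move=> /andP[z1 z2]; have [c|c] := leP p (z - t).
  by exists (z - t); [|exists t; [|ring]]; rewrite /= in_itv/=; apply/andP; split; lra.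
by exists p; [|exists (z - p); [|ring]]; rewrite /= in_itv/=; apply/andP; split; lra.
Qed.

Lemma interval_subE p q r t : p <= q -> r <= t ->
  interval_sub `[p, q] `[r, t] = `[p - t, q - r]%classic.
Proof.
move=> pq rt; apply/seteqP; split=> [_ [x + [y + <-]]|z] /=; rewrite !in_itv/=.
  by rewrite !in_itv/= => /andP[? ?] /andP[? ?]; apply/andP; split; lra.
move=> /andP[z1 z2]; have [c|c] := leP p (z + r).
  by exists (z + r); [|exists r; [|ring]]; rewrite /= in_itv/=; apply/andP; split; lra.
by exists p; [|exists (p - z); [|ring]]; rewrite /= in_itv/=; apply/andP; split; lra.
Qed.

Lemma eq_itvcc p q r t : p = r -> q = t -> `[p, q]%classic = `[r, t]%classic.
Proof. by move=> -> ->. Qed.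

Lemma cut_add a1 l1 r1 a2 l2 r2 u v :
  0 < l1 -> 0 < r1 -> 0 < l2 -> 0 < r2 -> 0 <= u -> 0 <= v ->
  `[a1 + a2 - (l1 + l2) * u, a1 + a2 + (r1 + r2) * v]%classic =
  interval_add `[a1 - l1 * u, a1 + r1 * v] `[a2 - l2 * u, a2 + r2 * v].
Proof.
move=> l10 r10 l20 r20 u0 v0; rewrite interval_addE; [|nra|nra].
by apply: eq_itvcc; ring.
Qed.

(** Subtraction adds a left spread of one number to a right spread of the other, so one factor [u]
    must serve both ends, in contrast with the [u] and [v] of [cut_add]. *)
Lemma cut_sub a1 l1 r1 a2 l2 r2 u :
  0 < l1 -> 0 < r1 -> 0 < l2 -> 0 < r2 -> 0 <= u ->
  `[a1 - a2 - (l1 + r2) * u, a1 - a2 + (r1 + l2) * u]%classic =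
  interval_sub `[a1 - l1 * u, a1 + r1 * u] `[a2 - l2 * u, a2 + r2 * u].
Proof.
move=> l10 r10 l20 r20 u0; rewrite interval_subE; [|nra|nra].
by apply: eq_itvcc; ring.
Qed.

End ShapeFunctions.

(** * LR-type numbers in terms of one-sided profiles *)

Section LRNumbers.
Context {K : realType} (L R L' R' : K -> K).
Hypotheses (hL : shape_function L) (hR : shape_function R).
Hypotheses (hL' : shape_function L') (hR' : shape_function R').
Implicit Types (A : lr_tuple K).

(* [mu] may be empty when the lower profile exceeds the upper one; its supremum
   is then 0, so the bound holds whatever the shape functions are. *)
Lemma lr_sup_condition A :
  [/\ 0 < lmuL A, 0 < rmuL A, 0 < lmuU A & 0 < rmuU A] ->
  [/\ 0 < lnuL A, 0 < rnuL A, 0 < lnuU A & 0 < rnuU A] ->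
  lmuU A <= lnuU A /\ rmuU A <= rnuU A ->
  sup_condition (lr_ivif L R L' R' A).
Proof.
move=> [_ _ m1 m2] [_ _ n1 n2] [c1 c2] x.
have /andP[mu0 mu1] := lr_profile_itv (mean A) x hL' hR' m1 m2.
have /andP[nu0 nu1] := lr_profile_itv (mean A) x hL' hR' n1 n2.
(* Both upper profiles use [L'] and [R'], so the wider non-membership spreads give the larger
   profile; hence [muU + nuU <= 1]. *)
have munu : lr_profile L' R' (mean A) (lmuU A) (rmuU A) x <=
            lr_profile L' R' (mean A) (lnuU A) (rnuU A) x.
  by move: x {mu0 mu1 nu0 nu1}; apply/lr_profile_leP => //;
    split=> t; exact: lr_side_spread.
have := @sup_itvcc_bounds _ (muL (lr_ivif L R L' R' A) x) _ mu0.
have nuU0 : 0 <= nuU (lr_ivif L R L' R' A) x by rewrite /=; lra.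
have := @sup_itvcc_bounds _ (nuL (lr_ivif L R L' R' A) x) _ nuU0.
rewrite /mu /nu /= => /andP[? ?] /andP[? ?]; apply/andP; split; lra.
Qed.

(** Lower and upper profiles have different shape functions, so the order of the spreads does not
    order the profiles; the two pointwise hypotheses supply this. *)
Lemma lr_ivifn_intro A : lr_conditions L R L' R' A ->
  (forall x, muL (lr_ivif L R L' R' A) x <= muU (lr_ivif L R L' R' A) x) ->
  (forall x, nuL (lr_ivif L R L' R' A) x <= nuU (lr_ivif L R L' R' A) x) ->
  lr_ivifn L R L' R' A.
Proof.
move=> cA mule nule; split=> //.
have [m1 m2 m3 m4] := lr_mu_gt0 cA; have [n1 n2 n3 n4] := lr_nu_gt0 cA.
split.
- split; last exact: lr_sup cA.
    move=> x; rewrite mule andbT /=.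
    have /andP[-> _] := lr_profile_itv (mean A) x hL hR m1 m2.
    by have /andP[_ ->] := lr_profile_itv (mean A) x hL' hR' m3 m4.
  move=> x; rewrite nule andbT /=.
  have /andP[_ ?] := lr_profile_itv (mean A) x hL hR n1 n2.
  have /andP[? _] := lr_profile_itv (mean A) x hL' hR' n3 n4.
  by split; lra.
- split; [exact: quasi_concave_lr_profile|exact: quasi_concave_lr_profile| |];
    by apply: quasi_convex_1sub; exact: quasi_concave_lr_profile.
(* Both membership profiles are 1 at the mean. The second point lies beyond both right
   non-membership spreads, where both non-membership bounds are 1. *)
- exists (mean A), (mean A + lnuL A + rnuL A + lnuU A + rnuU A).
  rewrite /mu /nu /= !lr_profile_mean// set_itv1; split=> //.
  by rewrite /lr_profile !ifF ?subr0 ?set_itv1//; lra.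
- have pc f g l r := @piecewise_continuous_lr_profile _ f g (mean A) l r.
  split; [exact: (pc _ _ _ _ hL hR)|exact: (pc _ _ _ _ hL' hR')| |];
    apply: piecewise_continuous_1sub.
  + exact: (pc _ _ _ _ hL hR).
  + exact: (pc _ _ _ _ hL' hR').
Qed.

(** The nonempty value intervals order the profiles. Since non-membership is 1 minus a profile, its
    order is reversed, with [L'] and [R'] on the smaller side. *)
Lemma lr_ivifn_sides A : lr_ivifn L R L' R' A ->
  [/\ forall t, lr_side L (lmuL A) t <= lr_side L' (lmuU A) t,
      forall t, lr_side R (rmuL A) t <= lr_side R' (rmuU A) t,
      forall t, lr_side L' (lnuU A) t <= lr_side L (lnuL A) t &
      forall t, lr_side R' (rnuU A) t <= lr_side R (rnuL A) t].
Proof.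
move=> [nA cA]; have [mI nI _] := ivifn_set nA.
have [m1 m2 m3 m4] := lr_mu_gt0 cA; have [n1 n2 n3 n4] := lr_nu_gt0 cA.
have [|h1 h2] := (lr_profile_leP (mean A) hL hR hL' hR' m1 m2 m3 m4).1.
  by move=> x; have [/andP[]] := mI x.
have [|h3 h4] := (lr_profile_leP (mean A) hL' hR' hL hR n3 n4 n1 n2).1.
  by move=> x; have [/andP[]] := nI x => /= _ ? _; lra.
by [].
Qed.

Lemma lr_ivifn_of_sides A : lr_conditions L R L' R' A ->
  (forall t, lr_side L (lmuL A) t <= lr_side L' (lmuU A) t) ->
  (forall t, lr_side R (rmuL A) t <= lr_side R' (rmuU A) t) ->
  (forall t, lr_side L' (lnuU A) t <= lr_side L (lnuL A) t) ->
  (forall t, lr_side R' (rnuU A) t <= lr_side R (rnuL A) t) ->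
  lr_ivifn L R L' R' A.
Proof.
move=> cA s1 s2 s3 s4.
have [m1 m2 m3 m4] := lr_mu_gt0 cA; have [n1 n2 n3 n4] := lr_nu_gt0 cA.
apply: lr_ivifn_intro => //=; first by apply/lr_profile_leP.
by move=> x; rewrite lerD2l lerN2; move: x; apply/lr_profile_leP.
Qed.

End LRNumbers.

(** The positive part in [lr_side] keeps the argument of the shape function in the half-line. *)
Lemma eq_lr_side (K : realType) (f g : K -> K) (l t : K) :
  {in `[0, +oo[, f =1 g} -> lr_side f l t = lr_side g l t.
Proof.
by move=> fg; rewrite /lr_side fg// in_itv/= andbT le_max lexx orbT.
Qed.

Theorem proposition3p1p1 (K : realType) (L R L' R' : K -> K)
    (hL : shape_function L) (hR : shape_function R)
    (hL' : shape_function L') (hR' : shape_function R')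
    (a1 l1muL r1muL l1muU r1muU l1nuL r1nuL l1nuU r1nuU : K)
    (a2 l2muL r2muL l2muU r2muU l2nuL r2nuL l2nuU r2nuU : K)
    (A1 := LR a1 l1muL r1muL l1muU r1muU l1nuL r1nuL l1nuU r1nuU)
    (A2 := LR a2 l2muL r2muL l2muU r2muU l2nuL r2nuL l2nuU r2nuU)
    (S := LR (a1 + a2)
             (l1muL + l2muL) (r1muL + r2muL) (l1muU + l2muU) (r1muU + r2muU)
             (l1nuL + l2nuL) (r1nuL + r2nuL) (l1nuU + l2nuU) (r1nuU + r2nuU))
    (D := LR (a1 - a2)
             (l1muL + r2muL) (r1muL + l2muL) (l1muU + r2muU) (r1muU + l2muU)
             (l1nuL + r2nuL) (r1nuL + l2nuL) (l1nuU + r2nuU) (r1nuU + l2nuU))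
    (hA1 : lr_ivifn L R L' R' A1) (hA2 : lr_ivifn L R L' R' A2) :
  (is_oplus L R L' R' A1 A2 S /\ lr_ivifn L R L' R' S) /\
  (({in `[0, +oo[, L =1 R} -> {in `[0, +oo[, L' =1 R'} ->
      is_ominus L R L' R' A1 A2 D /\ lr_ivifn L R L' R' D) /\
   lr_conditions L R L' R' D).

Proof.
have [_ c1] := hA1; have [_ c2] := hA2.
have [i1 i2 i3 i4] := lr_ivifn_sides hL hR hL' hR' hA1.
have [j1 j2 j3 j4] := lr_ivifn_sides hL hR hL' hR' hA2.
case: (c1) => /= [[p1 p2 p3 p4] [p5 p6 p7 p8] [p9 p10] [p11 p12] [p13 p14]
  [p15 p16] _].
case: (c2) => /= [[q1 q2 q3 q4] [q5 q6 q7 q8] [q9 q10] [q11 q12] [q13 q14]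
  [q15 q16] _].
rewrite /= in i1 i2 i3 i4 j1 j2 j3 j4.
have cS : lr_conditions L R L' R' S.
  by split=> /=; do ?split; rewrite ?addr_gt0 ?lerD//;
    apply: lr_sup_condition => //=; split; rewrite ?addr_gt0 ?lerD.
(* The spread inequalities have the same form on the left and on the right, so they also add
   crosswise. *)
have cD : lr_conditions L R L' R' D.
  by split=> /=; do ?split; rewrite ?addr_gt0 ?lerD//;
    apply: lr_sup_condition => //=; split; rewrite ?addr_gt0 ?lerD.
split; first split.
- move=> al be al01 be01 albe.
  (* Strict positivity comes from [al > 0] and [al + be <= 1]; it puts [1 - be] in the domain of the
     inverses. *)
  have be01' : 0 < 1 - be <= 1 by lra.
  by split; apply: cut_add => //; exact: shape_inv_ge0.
- by apply: lr_ivifn_of_sides => //=; apply: lr_side_add.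
split=> // eqLR eqL'R'; split.
- move=> al be al01 be01 albe.
  have be01' : 0 < 1 - be <= 1 by lra.
  have eLR x : 0 < x <= 1 -> shape_inv R x = shape_inv L x.
    by move=> x01; rewrite (eq_shape_inv hL hR eqLR).
  have eL'R' x : 0 < x <= 1 -> shape_inv R' x = shape_inv L' x.
    by move=> x01; rewrite (eq_shape_inv hL' hR' eqL'R').
  (* All inverses become those of [L] and [L'], giving both ends of each cut the common factor
     required by [cut_sub]. *)
  rewrite /cut_muL /cut_muU /cut_nuL /cut_nuU !eLR// !eL'R'//.
  by split; apply: cut_sub => //; exact: shape_inv_ge0.
- have eLR l t : lr_side L l t = lr_side R l t by exact: eq_lr_side.
  have eL'R' l t : lr_side L' l t = lr_side R' l t by exact: eq_lr_side.
  (* Each crossed spread needs a comparison known only for the opposite side's shape functions; the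
     equalities transport it. *)
  apply: lr_ivifn_of_sides => //=; apply: lr_side_add => // t;
    by [rewrite eLR eL'R' | rewrite -eLR -eL'R'].
Qed.
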